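(* Let $\alpha$ and $\beta$ be positive real numbers such that $\alpha\beta = \pi^2$, and let $m$ be a positive integer. Then $$\alpha^{-m}\left\{\frac{1}{2}\,\zeta(2m + 1) + \sum_{n = 1}^{\infty}\frac{n^{-2m - 1}}{e^{2\alpha n} - 1}\right\} -(- \beta)^{-m}\left\{\frac{1}{2}\,\zeta(2m + 1) + \sum_{n = 1}^{\infty}\frac{n^{-2m - 1}}{e^{2\beta n} - 1}\right\} = 2^{2m}\sum_{k = 0}^{m + 1}\frac{(-1)^{k-1}B_{2k}\,B_{2m - 2k+2}}{(2k)!\,(2m -2k+2)!}\,\alpha^{m - k + 1}\beta^k,$$ where $\zeta$ is the Riemann zeta function and $B_j$ denotes the $j$-th Bernoulli number.
   Context: The Bernoulli numbers $B_j$ ($j \geqslant 0$) are defined by the exponential generating function $\sum_{j\geqslant 0}B_{j}\frac{z^j}{j!}=\frac{z}{\exp(z)-1}$. The Riemann zeta function is $\zeta(s)=\sum_{n=1}^\infty n^{-s}$ for $\Re(s)>1$. *)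

(* Defs.v *)
From Stdlib Require Import Reals Factorial Arith Lra Lia.
From Coquelicot Require Import Coquelicot.
Open Scope R_scope.

(* The identity is required near 0 but not at 0, where z / (exp z - 1) has a
   removable singularity; it determines B. *)
Definition bernoulli_numbers (B : nat -> R) : Prop :=
  locally' 0 (fun z : R =>
    is_series (fun j => B j * (z ^ j / INR (fact j))) (z / (exp z - 1))).

(* Riemann zeta on the real half-line s > 1 (the sum starts at n = 1). *)
Definition zeta (s : R) : R :=
  Series (fun n => Rpower (INR (S n)) (- s)).

(* Existence of the Bernoulli numbers: [bern_row n k] is B_k / k! for k <= n,
   from the recursion sum_(j <= n) (B_j / j!) / (n + 1 - j)! = [n = 0]. *)
Fixpoint bern_row (n : nat) : nat -> R :=
  match n with
  | O => fun _ => 1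
  | S n' => fun k =>
      if Nat.leb k n' then bern_row n' k
      else - sum_f_R0 (fun j => bern_row n' j / INR (fact (n' + 2 - j))) n'
  end.

Definition bern_coef (n : nat) : R := bern_row n n.

Lemma bern_row_coef n k : (k <= n)%nat -> bern_row n k = bern_coef k.
Proof.
induction n as [|n IH]; intros Hk.
- now replace k with 0%nat by lia.
- destruct (Nat.eq_dec k (S n)) as [->|Hne]; [reflexivity|].
  cbn [bern_row]; destruct (Nat.leb_spec k n); [apply IH|]; lia.
Qed.

Lemma bern_coef_S n :
  bern_coef (S n) =
  - sum_f_R0 (fun j => bern_coef j / INR (fact (n + 2 - j))) n.
Proof.
unfold bern_coef at 1; cbn [bern_row].
destruct (Nat.leb_spec (S n) n); [lia|].
f_equal; apply sum_eq; intros j Hj; now rewrite bern_row_coef.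
Qed.

Lemma fact_lower n : 2 ^ n <= INR (fact (S n)).
Proof.
induction n as [|n IH]; [simpl; lra|].
change (fact (S (S n))) with (S (S n) * fact (S n))%nat.
rewrite mult_INR.
assert (2 <= INR (S (S n))) by (rewrite !S_INR; pose proof (pos_INR n); lra).
assert (0 < 2 ^ n) by (apply pow_lt; lra).
simpl (2 ^ S n); nra.
Qed.

Lemma inv_fact_bound n : 0 < / INR (fact (S n)) <= (/ 2) ^ n.
Proof.
split; [apply Rinv_0_lt_compat, INR_fact_lt_0|].
rewrite pow_inv; apply Rinv_le_contravar; [apply pow_lt; lra|apply fact_lower].
Qed.

Lemma sum_inv_fact n :
  sum_f_R0 (fun j => / INR (fact (n + 2 - j))) n <= 1 - (/ 2) ^ (S n).
Proof.
induction n as [|n IH]; [simpl; lra|].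
rewrite decomp_sum by lia.
simpl (pred (S n)).
rewrite (sum_eq _ (fun j => / INR (fact (n + 2 - j))) n)
  by (intros i Hi; do 3 f_equal; lia).
replace (S n + 2 - 0)%nat with (S (S (S n))) by lia.
pose proof (inv_fact_bound (S (S n))).
simpl ((/ 2) ^ _) in *; lra.
Qed.

Lemma bern_coef_bound n : Rabs (bern_coef n) <= 1.
Proof.
induction n as [n IH] using (well_founded_induction lt_wf).
destruct n as [|n].
- unfold bern_coef; simpl; rewrite Rabs_R1; lra.
- rewrite bern_coef_S, Rabs_Ropp.
  eapply Rle_trans; [apply Rsum_abs|].
  apply Rle_trans with (sum_f_R0 (fun j => / INR (fact (n + 2 - j))) n).
  + apply sum_Rle; intros j Hj.
    unfold Rdiv; rewrite Rabs_mult.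
    pose proof (Rinv_0_lt_compat _ (INR_fact_lt_0 (n + 2 - j))).
    rewrite (Rabs_pos_eq (/ _)) by lra.
    assert (Rabs (bern_coef j) <= 1) by (apply IH; lia).
    nra.
  + pose proof (sum_inv_fact n).
    assert (0 < (/ 2) ^ S n) by (apply pow_lt; lra).
    lra.
Qed.

Lemma CV_radius_of_bounded (a : nat -> R) :
  (forall n, Rabs (a n) <= 1) -> Rbar_le 1 (CV_radius a).
Proof.
intros Ha; apply (proj1 (CV_radius_bounded a)).
exists 1; intros n; rewrite pow1, Rmult_1_r; apply Ha.
Qed.

Lemma bernoulli_numbers_exist : exists B : nat -> R, bernoulli_numbers B.
Proof.
exists (fun j => bern_coef j * INR (fact j)).
exists (mkposreal 1 Rlt_0_1); intros z Hz Hz0.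
assert (Hz1 : Rabs z < 1).
{ unfold ball in Hz; simpl in Hz; unfold AbsRing_ball, abs, minus, plus, opp in Hz.
  simpl in Hz; now rewrite Ropp_0, Rplus_0_r in Hz. }
set (e := PS_decr_1 (fun n => / INR (fact n)) : nat -> R).
assert (He : forall n, Rabs (e n) <= 1).
{ intros n; unfold e, PS_decr_1.
  pose proof (inv_fact_bound n) as [H1 H2].
  rewrite Rabs_pos_eq by lra.
  apply Rle_trans with (1 := H2).
  rewrite <- (pow1 n); apply pow_incr; lra. }
assert (He1 : is_pseries e z ((exp z - 1) / z)).
{ replace ((exp z - 1) / z)
    with (scal (/ z) (plus (exp z) (opp (/ INR (fact 0))))).
  - apply (is_pseries_decr_1 (fun n => / INR (fact n)) z (/ z)).
    + apply Rinv_l; assumption.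
    + apply is_exp_Reals.
  - unfold scal, plus, opp; simpl; unfold mult; simpl; now field. }
assert (Rb : Rbar_lt (Rabs z) (CV_radius bern_coef)).
{ apply Rbar_lt_le_trans with 1; [exact Hz1|].
  apply CV_radius_of_bounded, bern_coef_bound. }
assert (Re : Rbar_lt (Rabs z) (CV_radius e)).
{ apply Rbar_lt_le_trans with 1; [exact Hz1|].
  now apply CV_radius_of_bounded. }
assert (Hb : is_pseries bern_coef z (PSeries bern_coef z)).
{ apply PSeries_correct, CV_disk_correct, CV_disk_inside, Rb. }
pose proof (is_pseries_mult _ _ _ _ _ Hb He1 Rb Re) as Hm.
assert (Hd : forall n, PS_mult bern_coef e n = if Nat.eqb n 0 then 1 else 0).
{ intros [|n]; unfold PS_mult, e, PS_decr_1.
  - unfold bern_coef; simpl; field.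
  - rewrite tech5, Nat.sub_diag, bern_coef_S; simpl (Nat.eqb _ _).
    rewrite (sum_eq _ (fun j => bern_coef j / INR (fact (n + 2 - j))) n).
    + simpl; field.
    + intros i Hi; unfold Rdiv; do 3 f_equal; f_equal; lia. }
assert (H1 : PSeries bern_coef z * ((exp z - 1) / z) = 1).
{ rewrite <- (is_pseries_unique _ _ _ Hm).
  rewrite (PSeries_ext _ _ z Hd).
  rewrite PSeries_decr_1.
  2: { apply (ex_pseries_ext (PS_mult bern_coef e)); [exact Hd|].
       eexists; exact Hm. }
  rewrite (PSeries_ext _ (fun _ => 0)) by reflexivity.
  rewrite PSeries_const_0; simpl; ring. }
assert (H2 : exp z - 1 <> 0).
{ intros E; rewrite E in H1; unfold Rdiv in H1; rewrite Rmult_0_l, Rmult_0_r in H1; lra. }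
replace (z / (exp z - 1)) with (PSeries bern_coef z).
2: { apply (Rmult_eq_reg_r ((exp z - 1) / z)).
     - rewrite H1; field; split; assumption.
     - unfold Rdiv; apply Rmult_integral_contrapositive_currified;
         [assumption|now apply Rinv_neq_0_compat]. }
apply (is_series_ext (fun n => scal (pow_n z n) (bern_coef n))).
2: exact Hb.
intros n; rewrite pow_n_pow; unfold scal; simpl; unfold mult; simpl.
field; apply INR_fact_neq_0.
Qed.

(* Main.v *)
Require Import Defs.
From Stdlib Require Import Reals Factorial Lra Lia.
From Coquelicot Require Import Coquelicot.
Open Scope R_scope.

(** Both sides are read off from the partial fractions of the hyperbolic
    cotangent,
    [coth x = 1 / x + sum_(k >= 1) 2 x / (x ^ 2 + k ^ 2 PI ^ 2)]
    ([coth_partial_fractions]).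

    On the left, [1 / 2 + 1 / (exp (2 alpha n) - 1) = coth (alpha n) / 2], so each
    brace is a sum of hyperbolic cotangents. As [PI ^ 2 = alpha beta], inserting the
    partial fractions turns it into [zeta (2m + 2) / (2 alpha)] plus the double sum
    of [n ^ (-2m) / (alpha n ^ 2 + beta k ^ 2)] ([lambert_sum_eq]). Write
    [a = alpha n ^ 2] and [b = beta k ^ 2]. After the exchange of the summations
    in the second double sum, the left side is the sum over [n] and [k] of
    [(a ^ (-m) - (- b) ^ (-m)) / (a + b)], apart from the two terms in
    [zeta (2m + 2)]. This quotient is a finite geometric sum of monomials
    [a ^ (-i-1) b ^ (i-m)], up to sign, so the double sum is a finite sum of
    products of two even zeta values ([lattice_sum_reciprocity]).

    On the right, expanding the partial fractions of [(z / 2) coth (z / 2)] into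
    geometric series and comparing with the generating function
    [z / (exp z - 1)] gives Euler's formula for [B_(2k)] in terms of [zeta (2k)]
    ([bernoulli_even]). The terms [0 < k < m + 1] are then the products above, and
    the terms [k = 0] and [k = m + 1], in which [B_0 = 1], are those in
    [zeta (2m + 2)].

    The partial fractions come from [2 coth (2 y) = coth y + coth (y + i PI / 2)].
    Iterated [N] times, it writes [coth x] as a finite sum over [k < 2 ^ N]
    ([coth_finite_sum]), whose real parts stay within real analysis; as [N]
    grows, Tannery's theorem ([tannery]) gives the limit. The same theorem
    provides the exchanges of summation ([is_series_swap]). *)


(** * Series: dominated convergence and exchange of summations *)

(** Generic series lemmas leave equations typed in the carrier of a normed
    module, which [ring] does not recognise as real equations. *)
Ltac eq_in_R := match goal with |- @eq _ ?a ?b => change (@eq R a b) end.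

Lemma ex_series_mult_l (c : R) (a : nat -> R) :
  ex_series a -> ex_series (fun n => c * a n).
Proof. exact (ex_series_scal_l (K := R_AbsRing) (V := R_NormedModule) c a). Qed.

Lemma is_series_mult_l (c : R) (a : nat -> R) (l : R) :
  is_series a l -> is_series (fun n => c * a n) (c * l).
Proof. exact (is_series_scal_l (K := R_AbsRing) (V := R_NormedModule) c a l). Qed.

Lemma is_series_add (a b : nat -> R) (la lb : R) :
  is_series a la -> is_series b lb -> is_series (fun n => a n + b n) (la + lb).
Proof. exact (is_series_plus (K := R_AbsRing) (V := R_NormedModule) a b la lb). Qed.

Lemma sum_f_R0_lim (f : nat -> nat -> R) (g : nat -> R) (K : nat) :
  (forall k, is_lim_seq (fun N => f N k) (g k)) ->
  is_lim_seq (fun N => sum_f_R0 (f N) K) (sum_f_R0 g K).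
Proof.
intros H; induction K as [|K IH]; simpl; [apply H|].
apply is_lim_seq_plus'; [apply IH|apply H].
Qed.

Lemma ex_series_abs_le (a u : nat -> R) :
  ex_series u -> (forall k, Rabs (a k) <= u k) -> ex_series a.
Proof. intros Hu H; apply (ex_series_le a u); [exact H|exact Hu]. Qed.

Lemma lim_abs_le (u : nat -> R) (l c : R) :
  is_lim_seq u l -> (forall N, Rabs (u N) <= c) -> Rabs l <= c.
Proof.
intros Hl Hc.
apply (is_lim_seq_le (fun N => Rabs (u N)) (fun _ => c) (Rabs l) c).
- exact Hc.
- exact (is_lim_seq_abs _ _ Hl).
- apply is_lim_seq_const.
Qed.

(** Dominated convergence for series: beyond a rank where the tail of [u] is
    small, both series are negligible, and below it there are finitely many
    terms. *)
Lemma tannery (f : nat -> nat -> R) (g u : nat -> R) :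
  ex_series u ->
  (forall N k, Rabs (f N k) <= u k) ->
  (forall k, is_lim_seq (fun N => f N k) (g k)) ->
  is_lim_seq (fun N => Series (f N)) (Series g).
Proof.
intros Hu Hf Hg.
assert (Hgu : forall k, Rabs (g k) <= u k)
  by (intros k; apply (lim_abs_le (fun N => f N k)); [apply Hg|intros N; apply Hf]).
assert (Hd : forall N k, Rabs (f N k - g k) <= 2 * u k).
{ intros N k; specialize (Hf N k); specialize (Hgu k).
  pose proof (Rabs_triang (f N k) (- g k)); rewrite Rabs_Ropp in *.
  unfold Rminus; lra. }
assert (H2u : ex_series (fun k => 2 * u k)) by now apply ex_series_mult_l.
apply is_lim_seq_spec; intros eps.
assert (HK : exists K, Series (fun k => u (S K + k)%nat) < eps / 4).
{ pose proof (Series_correct _ Hu) as HU; apply is_series_Reals in HU.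
  destruct (HU (eps / 4)) as [K HK]; [destruct eps; simpl; lra|].
  exists K; specialize (HK K (le_n K)).
  pose proof (Series_incr_n u (S K) ltac:(lia) Hu) as E; simpl pred in E.
  unfold Rdist in HK; apply Rabs_def2 in HK; lra. }
destruct HK as [K HK].
assert (Hfin : is_lim_seq (fun N => sum_f_R0 (fun k => f N k - g k) K) 0).
{ replace (Finite 0) with (Finite (sum_f_R0 (fun _ => 0) K))
    by (f_equal; rewrite sum_cte; ring).
  apply sum_f_R0_lim; intros k.
  replace (Finite 0) with (Finite (g k - g k)) by (f_equal; ring).
  apply is_lim_seq_minus'; [apply Hg|apply is_lim_seq_const]. }
apply is_lim_seq_spec in Hfin.
assert (He : 0 < eps / 2) by (destruct eps; simpl; lra).
destruct (Hfin (mkposreal _ He)) as [N0 HN0]; exists N0; intros N HN.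
specialize (HN0 N HN); simpl in HN0; rewrite Rminus_0_r in HN0.
assert (Hex : ex_series (fun k => f N k - g k))
  by (apply (ex_series_abs_le _ _ H2u), Hd).
assert (Htu : ex_series (fun k => 2 * u (S K + k)%nat)).
{ now apply (ex_series_incr_n (fun k => 2 * u k) (S K)). }
assert (Ht : Rabs (Series (fun k => f N (S K + k)%nat - g (S K + k)%nat))
             <= 2 * Series (fun k => u (S K + k)%nat)).
{ rewrite <- Series_scal_l.
  eapply Rle_trans; [apply Series_Rabs|apply Series_le; [|exact Htu]].
  - apply (ex_series_abs_le _ _ Htu); intros k; rewrite Rabs_Rabsolu; apply Hd.
  - intros k; split; [apply Rabs_pos|apply Hd]. }
rewrite <- Series_minus.
2: now apply (ex_series_abs_le _ u). 2: now apply (ex_series_abs_le _ u).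
rewrite (Series_incr_n _ (S K) ltac:(lia) Hex); simpl pred.
eapply Rle_lt_trans; [apply Rabs_triang|].
lra.
Qed.

Lemma Series_sum_f_R0 (f : nat -> nat -> R) (n : nat) :
  (forall j, ex_series (f j)) ->
  is_series (fun k => sum_f_R0 (fun j => f j k) n)
            (sum_f_R0 (fun j => Series (f j)) n).
Proof.
intros H; induction n as [|n IH]; simpl; [apply Series_correct, H|].
apply (is_series_plus _ _ _ _ IH); apply Series_correct, H.
Qed.

Lemma sum_f_R0_le_Series (u : nat -> R) (n : nat) :
  ex_series u -> (forall k, 0 <= u k) -> sum_f_R0 u n <= Series u.
Proof.
intros Hu Hp; apply sum_incr; [|exact Hp].
apply (proj1 (is_series_Reals u (Series u))), Series_correct, Hu.
Qed.

(** Fubini for a double series dominated by a product: apply Tannery's theorem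
    to the finite sums over [j <= n], with majorant [Series u * v k]. *)
Lemma is_series_swap (f : nat -> nat -> R) (u v : nat -> R) :
  ex_series u -> ex_series v -> (forall j, 0 <= u j) -> (forall k, 0 <= v k) ->
  (forall j k, Rabs (f j k) <= u j * v k) ->
  is_series (fun j => Series (f j)) (Series (fun k => Series (fun j => f j k))).
Proof.
intros Hu Hv Hu0 Hv0 Hf.
assert (Hrow : forall j, ex_series (f j)).
{ intros j; apply (ex_series_abs_le _ (fun k => u j * v k)); [|apply Hf].
  now apply ex_series_mult_l. }
assert (Hcol : forall k, ex_series (fun j => f j k)).
{ intros k; apply (ex_series_abs_le _ (fun j => u j * v k)); [|intros j; apply Hf].
  apply (ex_series_ext (fun j => v k * u j)); 
    [intros; apply Rmult_comm|now apply ex_series_mult_l]. }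
apply is_series_Reals, is_lim_seq_Reals.
apply (is_lim_seq_ext (fun n => Series (fun k => sum_f_R0 (fun j => f j k) n))).
{ intros n; apply is_series_unique, Series_sum_f_R0, Hrow. }
apply tannery with (u := fun k => Series u * v k).
- now apply ex_series_mult_l.
- intros n k; eapply Rle_trans; [apply Rsum_abs|].
  apply Rle_trans with (sum_f_R0 (fun j => u j * v k) n).
  + apply sum_Rle; intros j _; apply Hf.
  + rewrite <- scal_sum, Rmult_comm.
    apply Rmult_le_compat_r; [apply Hv0|now apply sum_f_R0_le_Series].
- intros k; apply is_lim_seq_Reals, is_series_Reals, Series_correct, Hcol.
Qed.

(** Comparison with a telescoping series, by
    [1 / n ^ 2 <= 2 (1 / n - 1 / (n + 1))]. *)
Lemma ex_series_inv_sqr : ex_series (fun n => / INR (S n) ^ 2).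
Proof.
assert (H : ex_series (fun n => 2 * (/ INR (S n) - / INR (S (S n))))).
{ apply ex_series_mult_l; exists 1.
  apply is_series_Reals, is_lim_seq_Reals.
  apply (is_lim_seq_ext (fun n => 1 - / INR (S (S n)))).
  { induction n as [|n IH]; [simpl; lra|].
    rewrite tech5, <- IH; lra. }
  replace (Finite 1) with (Finite (1 - 0)) by (f_equal; lra).
  apply is_lim_seq_minus'; [apply is_lim_seq_const|].
  apply (is_lim_seq_incr_1 (fun n => / INR (S n))).
  apply (is_lim_seq_incr_1 (fun n => / INR n)).
  apply (is_lim_seq_inv _ p_infty); [apply is_lim_seq_INR|discriminate]. }
apply (ex_series_abs_le _ _ H); intros n.
pose proof (lt_0_INR (S n) ltac:(lia)) as Hn.
rewrite Rabs_pos_eq by (left; apply Rinv_0_lt_compat, pow_lt, Hn).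
rewrite (S_INR (S n)); set (x := INR (S n)) in *.
assert (Hx : 1 <= x) by (unfold x; rewrite S_INR; pose proof (pos_INR n); lra).
replace (2 * (/ x - / (x + 1))) with (/ x ^ 2 + (x - 1) / (x ^ 2 * (x + 1)))
  by (field; lra).
enough (0 <= (x - 1) / (x ^ 2 * (x + 1))) by lra.
apply Rle_div_r; [apply Rlt_gt, Rmult_lt_0_compat; nra|nra].
Qed.

Lemma inv_pow_le_sqr (n s : nat) :
  (2 <= s)%nat -> 0 < / INR (S n) ^ s <= / INR (S n) ^ 2.
Proof.
intros Hs; pose proof (lt_0_INR (S n) ltac:(lia)) as Hn.
split; [apply Rinv_0_lt_compat, pow_lt, Hn|].
apply Rinv_le_contravar; [apply pow_lt, Hn|].
apply Rle_pow; [rewrite S_INR; pose proof (pos_INR n); lra|lia].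
Qed.

Lemma ex_series_inv_pow (s : nat) :
  (2 <= s)%nat -> ex_series (fun n => / INR (S n) ^ s).
Proof.
intros Hs; apply (ex_series_abs_le _ _ ex_series_inv_sqr); intros n.
pose proof (inv_pow_le_sqr n s Hs); rewrite Rabs_pos_eq; lra.
Qed.

(** * Partial fractions of the hyperbolic cotangent *)

Lemma cosh_sinh_sqr y : cosh y ^ 2 = 1 + sinh y ^ 2.
Proof.
unfold cosh, sinh; rewrite exp_Ropp.
pose proof (exp_pos y); field; lra.
Qed.

Lemma sinh_double y : sinh (2 * y) = 2 * sinh y * cosh y.
Proof.
unfold cosh, sinh; replace (2 * y) with (y + y) by ring.
rewrite !exp_Ropp, exp_plus; pose proof (exp_pos y); field; lra.
Qed.

Lemma cosh_double y : cosh (2 * y) = cosh y ^ 2 + sinh y ^ 2.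
Proof.
unfold cosh, sinh; replace (2 * y) with (y + y) by ring.
rewrite !exp_Ropp, exp_plus; pose proof (exp_pos y); field; lra.
Qed.

Lemma cosh_pos y : 0 < cosh y.
Proof. unfold cosh; pose proof (exp_pos y); pose proof (exp_pos (- y)); lra. Qed.

Lemma sinh_pos y : 0 < y -> 0 < sinh y.
Proof. intros H; rewrite <- sinh_0; now apply sinh_lt. Qed.

(** The [k]-th of the [2 ^ N] terms into which iterated duplication breaks
    [coth x]. It is [2 ^ -N] times the real part of
    [coth ((x + i k PI) / 2 ^ N)]. *)
Definition coth_term (x : R) (N k : nat) : R :=
  let d := / 2 ^ N in
  d * (sinh (x * d) * cosh (x * d)) /
    (sinh (x * d) ^ 2 + sin (INR k * PI * d) ^ 2).

(** The duplication formula [2 coth (2 y) = coth y + coth (y + i PI / 2)], in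
    real parts: with [s = sinh], [t = sin ^ 2] and [1 - t = cos ^ 2] at the halved
    arguments, the denominator on the left factors as
    [4 (s ^ 2 + t) (s ^ 2 + 1 - t)], and the numerator is [2 sinh cosh] times the
    sum of the two factors. *)
Lemma coth_term_split x N k :
  0 < x ->
  coth_term x N k = coth_term x (S N) k + coth_term x (S N) (k + 2 ^ N).
Proof.
intros Hx; unfold coth_term; cbv zeta.
assert (HN : 0 < 2 ^ N) by (apply pow_lt; lra).
set (d := / 2 ^ S N).
assert (Hd : / 2 ^ N = 2 * d) by (unfold d; simpl; field; lra).
assert (Hd0 : 0 < d) by (unfold d; apply Rinv_0_lt_compat; simpl; lra).
rewrite Hd.
replace (x * (2 * d)) with (2 * (x * d)) by ring.
replace (INR k * PI * (2 * d)) with (2 * (INR k * PI * d)) by ring.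
replace (INR (k + 2 ^ N) * PI * d) with (PI / 2 + INR k * PI * d).
2: { rewrite plus_INR, pow_INR; change (INR 2) with 2.
     unfold d; simpl; field; lra. }
assert (Hs : 0 < sinh (x * d)) by (apply sinh_pos; nra).
rewrite sinh_double, cosh_double, sin_2a, sin_plus, sin_PI2, cos_PI2.
pose proof (sin2_cos2 (INR k * PI * d)) as Hsc; unfold Rsqr in Hsc.
pose proof (cosh_sinh_sqr (x * d)) as Hc.
set (s := sinh _) in *; set (c := cosh _) in *.
set (si := sin _) in *; set (co := cos _) in *.
replace ((2 * s * c) ^ 2 + (2 * si * co) ^ 2)
  with (4 * ((s ^ 2 + si ^ 2) * (s ^ 2 + co ^ 2))).
2: { replace (co ^ 2) with (1 - si ^ 2) by (rewrite <- Hsc; ring).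
     replace ((2 * s * c) ^ 2) with (4 * s ^ 2 * c ^ 2) by ring.
     replace ((2 * si * co) ^ 2) with (4 * si ^ 2 * co ^ 2) by ring.
     replace (co ^ 2) with (1 - si ^ 2) by (rewrite <- Hsc; ring).
     rewrite Hc; ring. }
replace (c ^ 2 + s ^ 2) with ((s ^ 2 + si ^ 2) + (s ^ 2 + co ^ 2))
  by (rewrite Hc, <- Hsc; ring).
replace (1 * co + 0 * si) with co by ring.
field; nra.
Qed.

Lemma coth_finite_sum x N :
  0 < x -> cosh x / sinh x = sum_n (coth_term x N) (2 ^ N - 1).
Proof.
intros Hx; induction N as [|N IH].
- simpl; rewrite sum_O; unfold coth_term; simpl.
  rewrite Rinv_1, !Rmult_1_r, !Rmult_0_l, sin_0.
  pose proof (sinh_pos x Hx); field; lra.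
- rewrite IH.
  assert (H1 : (1 <= 2 ^ N)%nat) by (apply (Nat.pow_le_mono_r 2 0 N); lia).
  rewrite (sum_n_ext _ (fun k => plus (coth_term x (S N) k) (coth_term x (S N) (k + 2 ^ N))))
    by (intros k; now apply coth_term_split).
  rewrite sum_n_plus; unfold plus; simpl AbelianMonoid.plus.
  rewrite !sum_n_Reals.
  rewrite (tech2 _ (2 ^ N - 1) (2 ^ S N - 1)) by (simpl; lia).
  replace (2 ^ S N - 1 - S (2 ^ N - 1))%nat with (2 ^ N - 1)%nat by (simpl; lia).
  f_equal; apply sum_eq; intros i Hi; f_equal; lia.
Qed.

Lemma coth_term_reflect x N k :
  (k <= 2 ^ N)%nat -> coth_term x N (2 ^ N - k) = coth_term x N k.
Proof.
intros Hk; unfold coth_term; cbv zeta.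
assert (HN : 0 < 2 ^ N) by (apply pow_lt; lra).
replace (INR (2 ^ N - k) * PI * / 2 ^ N) with (PI - INR k * PI * / 2 ^ N).
- now rewrite sin_PI_x.
- rewrite minus_INR, pow_INR by exact Hk; change (INR 2) with 2; field; lra.
Qed.

(** Folding the sum over [k < 2 ^ (M + 1)] by the symmetry
    [k <-> 2 ^ (M + 1) - k] keeps the angles [k PI / 2 ^ (M + 1)] within
    [[0, PI / 2]]. There the sine is at least a fixed multiple of its argument,
    and this makes a bound uniform in [M] possible. *)
Lemma coth_half_sum x M :
  0 < x ->
  cosh x / sinh x =
  coth_term x (S M) 0 - coth_term x (S M) (2 ^ M) +
  2 * sum_f_R0 (fun j => coth_term x (S M) (S j)) (2 ^ M - 1).
Proof.
intros Hx; rewrite (coth_finite_sum x (S M) Hx), sum_n_Reals.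
assert (H1 : (1 <= 2 ^ M)%nat) by (apply (Nat.pow_le_mono_r 2 0 M); lia).
rewrite (tech2 _ (2 ^ M - 1) (2 ^ S M - 1)) by (simpl; lia).
replace (2 ^ S M - 1 - S (2 ^ M - 1))%nat with (2 ^ M - 1)%nat by (simpl; lia).
rewrite <- (sum_f_R0_skip (fun i => coth_term x (S M) (S (2 ^ M - 1) + i))).
rewrite (sum_eq (fun k => coth_term x (S M) (S (2 ^ M - 1) + (2 ^ M - 1 - k)))
           (fun j => coth_term x (S M) (S j))).
2: { intros j Hj; rewrite <- (coth_term_reflect x (S M) (S j)) by (simpl; lia).
     f_equal; simpl; lia. }
pose proof (decomp_sum (coth_term x (S M)) (2 ^ M) ltac:(lia)) as E.
destruct (2 ^ M)%nat as [|h]; [lia|].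
rewrite tech5 in E; simpl pred in E.
replace (S h - 1)%nat with h by lia; lra.
Qed.

(** From [sin u >= u - u ^ 3 / 6] and [u <= PI / 2 <= 2]. *)
Lemma sin_ge_third u : 0 <= u <= PI / 2 -> u / 3 <= sin u.
Proof.
intros [H0 H1]; pose proof PI_4.
destruct (SIN u H0 ltac:(lra)) as [Hl _].
unfold sin_lb, sin_approx, sin_term in Hl; simpl in Hl.
assert (u * u <= 4) by nra.
assert (u * (u * u) <= u * 4) by (apply Rmult_le_compat_l; lra).
assert (E : 0 <= u * u * u * u * u * (42 - u * u) / 5040).
{ apply Rmult_le_pos; [|lra].
  assert (0 <= u * u) by nra.
  repeat apply Rmult_le_pos; lra. }
lra.
Qed.

Lemma sinh_le_mul_exp y : 0 <= y -> sinh y <= y * exp y.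
Proof.
intros Hy; unfold sinh.
pose proof (exp_ineq1_le (- y)) as H1.
pose proof (exp_pos y); pose proof (exp_ineq1_le y).
assert (exp y * exp (- y) = 1) by (rewrite <- exp_plus, Rplus_opp_r; apply exp_0).
nra.
Qed.

(** The majorant for Tannery's theorem. With [d = 2 ^ -(M + 1)] the numerator is
    at most [d * (x * d * exp (2 * x))], and the denominator at least
    [(k * d) ^ 2] since [sin (k PI d) >= k PI d / 3] and [PI >= 3]; the powers of [d]
    cancel. *)
Lemma coth_term_bound x M k :
  0 < x -> (1 <= k <= 2 ^ M)%nat ->
  0 <= coth_term x (S M) k <= x * exp (2 * x) * / INR k ^ 2.
Proof.
intros Hx [Hk1 Hk2]; unfold coth_term; cbv zeta.
assert (HM : 1 <= 2 ^ M) by (apply pow_R1_Rle; lra).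
apply le_INR in Hk1, Hk2; rewrite pow_INR in Hk2; simpl (INR 1) in Hk1.
change (INR 2) with 2 in Hk2.
set (d := / 2 ^ S M).
assert (Hd : d * 2 ^ M = / 2) by (unfold d; simpl; field; lra).
assert (Hd0 : 0 < d) by (apply Rinv_0_lt_compat; simpl; lra).
assert (Hd1 : d <= 1 / 2) by nra.
set (K := INR k) in *.
pose proof PI2_3_2 as HPI.
assert (HKd : 0 < K * d <= / 2) by (split; nra).
assert (Hsin : K * d <= sin (K * PI * d)).
{ replace (K * PI * d) with (K * d * PI) by ring.
  pose proof (sin_ge_third (K * d * PI) ltac:(split; nra)); nra. }
assert (Hs : 0 < sinh (x * d)) by (apply sinh_pos; nra).
assert (Hc : 0 < cosh (x * d)) by apply cosh_pos.
assert (Hsc : sinh (x * d) * cosh (x * d) <= x * d * exp (2 * x)).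
{ pose proof (sinh_double (x * d)).
  pose proof (sinh_le_mul_exp (2 * (x * d)) ltac:(nra)).
  assert (exp (2 * (x * d)) <= exp (2 * x)).
  { destruct (Rle_lt_or_eq_dec (2 * (x * d)) (2 * x) ltac:(nra)) as [Hlt|Heq].
    - left; now apply exp_increasing.
    - right; now rewrite Heq. }
  assert (x * d * exp (2 * (x * d)) <= x * d * exp (2 * x))
    by (apply Rmult_le_compat_l; nra).
  lra. }
assert (Hden : (K * d) ^ 2 <= sinh (x * d) ^ 2 + sin (K * PI * d) ^ 2) by nra.
assert (HKd2 : 0 < (K * d) ^ 2) by (apply pow_lt; lra).
split.
- apply Rle_div_r; [lra|].
  rewrite Rmult_0_l; apply Rmult_le_pos; [lra|]; nra.
- replace (x * exp (2 * x) * / K ^ 2)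
    with (d * (x * d * exp (2 * x)) * / (K * d) ^ 2) by (field; lra).
  apply Rmult_le_compat.
  + apply Rmult_le_pos; [lra|]; nra.
  + left; apply Rinv_0_lt_compat; lra.
  + apply Rmult_le_compat_l; lra.
  + apply Rinv_le_contravar; assumption.
Qed.

Lemma is_lim_seq_inv_pow2 : is_lim_seq (fun N => / 2 ^ N) 0.
Proof.
apply (is_lim_seq_ext (fun N => (/ 2) ^ N)); [intros N; now rewrite pow_inv|].
apply is_lim_seq_geom; rewrite Rabs_pos_eq; lra.
Qed.

(** The difference quotient of [f] at 0 along the steps [a / 2 ^ N]. *)
Lemma rescaled_lim (f : R -> R) (l a : R) :
  f 0 = 0 -> is_derive f 0 l ->
  is_lim_seq (fun N => 2 ^ N * f (a * / 2 ^ N)) (l * a).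
Proof.
intros Hf0 Hf.
destruct (Req_dec a 0) as [->|Ha].
{ apply (is_lim_seq_ext (fun _ => 0)).
  - intros N; rewrite Rmult_0_l, Hf0; ring.
  - rewrite Rmult_0_r; apply is_lim_seq_const. }
apply (is_lim_seq_ext (fun N => f (a * / 2 ^ N) / (a * / 2 ^ N) * a)).
{ intros N; assert (0 < 2 ^ N) by (apply pow_lt; lra); field; split; lra. }
apply is_lim_seq_mult'; [|apply is_lim_seq_const].
apply is_derive_Reals in Hf.
apply is_lim_seq_spec; intros eps.
destruct (Hf eps (cond_pos eps)) as [delta Hdelta].
assert (L : is_lim_seq (fun N => a * / 2 ^ N) 0).
{ replace (Finite 0) with (Finite (a * 0)) by (f_equal; ring).
  apply is_lim_seq_mult'; [apply is_lim_seq_const|apply is_lim_seq_inv_pow2]. }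
apply is_lim_seq_spec in L; destruct (L delta) as [N0 HN0].
exists N0; intros N HN; specialize (HN0 N HN); rewrite Rminus_0_r in HN0.
specialize (Hdelta (a * / 2 ^ N)); rewrite Rplus_0_l, Hf0, Rminus_0_r in Hdelta.
apply Hdelta; [|exact HN0].
apply Rmult_integral_contrapositive_currified; [exact Ha|].
apply Rinv_neq_0_compat, pow_nonzero; lra.
Qed.

Lemma coth_term_lim x k :
  0 < x ->
  is_lim_seq (fun N => coth_term x N k) (x / (x ^ 2 + (INR k * PI) ^ 2)).
Proof.
intros Hx; set (a := INR k * PI).
assert (Hs : is_lim_seq (fun N => 2 ^ N * sinh (x * / 2 ^ N)) x).
{ replace (Finite x) with (Finite (cosh 0 * x)) by (f_equal; rewrite cosh_0; ring).
  apply rescaled_lim; [apply sinh_0|].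
  apply is_derive_Reals, derivable_pt_lim_sinh. }
assert (Hsin : is_lim_seq (fun N => 2 ^ N * sin (a * / 2 ^ N)) a).
{ replace (Finite a) with (Finite (cos 0 * a)) by (f_equal; rewrite cos_0; ring).
  apply rescaled_lim; [apply sin_0|].
  apply is_derive_Reals, derivable_pt_lim_sin. }
assert (Hc : is_lim_seq (fun N => cosh (x * / 2 ^ N)) 1).
{ replace (Finite 1) with (Finite (cosh (x * 0))) by (f_equal; rewrite Rmult_0_r; apply cosh_0).
  apply (is_lim_seq_continuous (fun t => cosh (x * t)) (fun N => / 2 ^ N) 0).
  - apply derivable_continuous_pt.
    apply (derivable_pt_comp (fun t => x * t) cosh).
    + apply derivable_pt_mult; [apply derivable_pt_const|apply derivable_pt_id].
    + apply derivable_pt_cosh.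
  - apply is_lim_seq_inv_pow2. }
apply (is_lim_seq_ext (fun N =>
  (2 ^ N * sinh (x * / 2 ^ N)) * cosh (x * / 2 ^ N) /
  ((2 ^ N * sinh (x * / 2 ^ N)) * (2 ^ N * sinh (x * / 2 ^ N)) +
   (2 ^ N * sin (a * / 2 ^ N)) * (2 ^ N * sin (a * / 2 ^ N))))).
{ intros N; unfold coth_term; cbv zeta; fold a.
  assert (HN : 0 < 2 ^ N) by (apply pow_lt; lra).
  assert (0 < sinh (x * / 2 ^ N)).
  { apply sinh_pos, Rmult_lt_0_compat; [lra|now apply Rinv_0_lt_compat]. }
  set (s := sinh _) in *; set (u := sin _); set (e := 2 ^ N) in *.
  assert (0 < s * s) by nra. assert (0 <= u * u) by nra.
  field.
  assert (0 < e * e) by nra.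
  repeat split; [lra|nra|].
  replace (e * s * (e * s) + e * u * (e * u)) with (e * e * (s * s + u * u)) by ring.
  apply Rgt_not_eq, Rmult_lt_0_compat; lra. }
replace (x / (x ^ 2 + a ^ 2)) with (x * 1 / (x * x + a * a)) by (field; nra).
apply is_lim_seq_div'; [|apply is_lim_seq_plus'; apply is_lim_seq_mult'; assumption|nra].
apply is_lim_seq_mult'; assumption.
Qed.

(** Let [M] tend to infinity in the folded sum: the term [k = 0] tends to
    [1 / x], the end term [k = 2 ^ M] to 0, and the other terms are handled by
    Tannery's theorem. *)
Lemma coth_partial_fractions_pos x :
  0 < x ->
  is_series (fun k => 2 * x / (x ^ 2 + (INR (S k) * PI) ^ 2))
            (cosh x / sinh x - 1 / x).
Proof.
intros Hx.
set (g := fun k => x / (x ^ 2 + (INR (S k) * PI) ^ 2)).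
set (f := fun M k => if Nat.ltb k (2 ^ M) then coth_term x (S M) (S k) else 0).
set (u := fun k => x * exp (2 * x) * / INR (S k) ^ 2).
assert (Hu : ex_series u) by apply ex_series_mult_l, ex_series_inv_sqr.
assert (Hup : forall k, 0 < u k).
{ intros k; unfold u; pose proof (exp_pos (2 * x)).
  pose proof (inv_pow_le_sqr k 2 (le_n 2)).
  apply Rmult_lt_0_compat; [nra|lra]. }
assert (Hf : forall M k, Rabs (f M k) <= u k).
{ intros M k; unfold f; destruct (Nat.ltb_spec k (2 ^ M)) as [H|H].
  - pose proof (coth_term_bound x M (S k) Hx ltac:(lia)) as [H0 H1].
    rewrite Rabs_pos_eq; assumption.
  - rewrite Rabs_R0; left; apply Hup. }
assert (Hp2 : forall M, (M < 2 ^ M)%nat) by (intros M; apply Nat.pow_gt_lin_r; lia).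
assert (Hg : forall k, is_lim_seq (fun M => f M k) (g k)).
{ intros k; apply (is_lim_seq_ext_loc (fun M => coth_term x (S M) (S k))).
  - exists k; intros M HM; unfold f.
    destruct (Nat.ltb_spec k (2 ^ M)); [reflexivity|specialize (Hp2 M); lia].
  - apply (is_lim_seq_incr_1 (fun M => coth_term x M (S k))).
    now apply coth_term_lim. }
assert (Hex : ex_series g).
{ apply (ex_series_abs_le _ u Hu); intros k.
  apply (lim_abs_le (fun M => f M k)); [apply Hg|intros M; apply Hf]. }
(* extended by zero, the finite sums become series over a common index set *)
assert (HS : forall M, Series (f M) =
  sum_f_R0 (fun j => coth_term x (S M) (S j)) (2 ^ M - 1)).
{ intros M; specialize (Hp2 M).
  rewrite (Series_incr_n (f M) (2 ^ M)); [|lia|apply (ex_series_abs_le _ u Hu), Hf].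
  rewrite (Series_ext (fun k => f M (2 ^ M + k)%nat) (fun _ => 0 * 0)).
  2: { intros k; unfold f; destruct (Nat.ltb_spec (2 ^ M + k) (2 ^ M)); [lia|ring]. }
  rewrite Series_scal_l, Rmult_0_l, Rplus_0_r, <- Nat.sub_1_r.
  apply sum_eq; intros j Hj; unfold f.
  destruct (Nat.ltb_spec j (2 ^ M)); [reflexivity|lia]. }
assert (Hlast : is_lim_seq (fun M => coth_term x (S M) (2 ^ M)) 0).
{ apply (is_lim_seq_le_le (fun _ => 0) _ (fun M => x * exp (2 * x) * / 2 ^ M)).
  - intros M; specialize (Hp2 M).
    pose proof (coth_term_bound x M (2 ^ M) Hx ltac:(lia)) as [H0 H1].
    split; [exact H0|]; eapply Rle_trans; [exact H1|].
    pose proof (exp_pos (2 * x)).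
    apply Rmult_le_compat_l; [nra|].
    rewrite pow_INR; change (INR 2) with 2.
    assert (1 <= 2 ^ M) by (apply pow_R1_Rle; lra).
    apply Rinv_le_contravar; nra.
  - apply is_lim_seq_const.
  - replace (Finite 0) with (Finite (x * exp (2 * x) * 0)) by (f_equal; ring).
    apply is_lim_seq_mult'; [apply is_lim_seq_const|apply is_lim_seq_inv_pow2]. }
assert (L : is_lim_seq (fun _ => cosh x / sinh x) (1 / x - 0 + 2 * Series g)).
{ apply (is_lim_seq_ext (fun M =>
    coth_term x (S M) 0 - coth_term x (S M) (2 ^ M) + 2 * Series (f M))).
  { intros M; rewrite HS; symmetry; now apply coth_half_sum. }
  apply is_lim_seq_plus'; [apply is_lim_seq_minus'|].
  - apply (is_lim_seq_incr_1 (fun M => coth_term x M 0)).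
    replace (1 / x) with (x / (x ^ 2 + (INR 0 * PI) ^ 2)) by (simpl; field; lra).
    now apply coth_term_lim.
  - exact Hlast.
  - apply is_lim_seq_mult'; [apply is_lim_seq_const|].
    now apply tannery with u. }
apply is_lim_seq_unique in L; rewrite Lim_seq_const in L; injection L as L.
rewrite L; replace (1 / x - 0 + 2 * Series g - 1 / x) with (2 * Series g) by ring.
apply (is_series_ext (fun k => 2 * g k)).
{ intros k; unfold g; simpl; unfold Rdiv; ring. }
now apply is_series_mult_l, Series_correct.
Qed.

Lemma coth_partial_fractions x :
  x <> 0 ->
  is_series (fun k => 2 * x / (x ^ 2 + (INR (S k) * PI) ^ 2))
            (cosh x / sinh x - 1 / x).
Proof.
intros Hx; destruct (Rlt_or_le 0 x) as [H|H]; [now apply coth_partial_fractions_pos|].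
pose proof (coth_partial_fractions_pos (- x) ltac:(lra)) as P.
apply (is_series_mult_l (-1)) in P.
assert (Ec : cosh (- x) = cosh x) by (unfold cosh; rewrite Ropp_involutive; lra).
assert (Es : sinh (- x) = - sinh x) by (unfold sinh; rewrite Ropp_involutive; lra).
assert (Hs : sinh (- x) > 0) by (apply sinh_pos; lra).
rewrite Ec, Es in P.
replace (cosh x / sinh x - 1 / x) with (-1 * (cosh x / - sinh x - 1 / - x))
  by (field; lra).
eapply is_series_ext; [|exact P].
intros k; simpl.
replace (- x * (- x * 1)) with (x * (x * 1)) by ring; unfold Rdiv; ring.
Qed.

(** * Even zeta values and Bernoulli numbers *)

Definition zeta_nat (s : nat) : R := Series (fun n => / INR (S n) ^ s).

Lemma zeta_INR s : zeta (INR s) = zeta_nat s.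
Proof.
apply Series_ext; intros n.
now rewrite Rpower_Ropp, Rpower_pow by (apply lt_0_INR; lia).
Qed.

(** Euler's value of [B_(2n) / (2n)!]. *)
Definition bern_even_coef (n : nat) : R :=
  match n with
  | O => 1
  | S j => 2 * (-1) ^ j * zeta_nat (2 * S j) * (/ (2 * PI)) ^ (2 * S j)
  end.

(** The value found here for [B_n / n!], with [B_1 = -1/2] as the only odd
    index that contributes. *)
Definition bern_egf_coef (n : nat) : R :=
  if Nat.even n then bern_even_coef (Nat.div2 n)
  else if Nat.eqb n 1 then - (1 / 2) else 0.

(** Each partial fraction of [y coth y], [y = z / 2], is a geometric series in
    [q = (z / (2 PI k)) ^ 2]. As [|z| < 1 < 2 PI], the resulting double series is
    dominated by [2 w ^ (j + 1) / k ^ 2] with [w = (z / (2 PI)) ^ 2 < 1], and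
    summing over [k] first produces the even zeta values. *)
Lemma coth_power_series z :
  z <> 0 -> Rabs z < 1 ->
  is_series (fun j => bern_even_coef (S j) * (z ^ 2) ^ S j)
            (z / 2 * (cosh (z / 2) / sinh (z / 2)) - 1).
Proof.
intros Hz Hz1.
pose proof PI2_3_2 as HPI.
pose proof (coth_partial_fractions (z / 2) ltac:(lra)) as HC.
apply (is_series_mult_l (z / 2)) in HC.
replace (z / 2 * (cosh (z / 2) / sinh (z / 2)) - 1)
  with (z / 2 * (cosh (z / 2) / sinh (z / 2) - 1 / (z / 2)))
  by (set (c := cosh (z / 2) / sinh (z / 2)); field; lra).
rewrite <- (is_series_unique _ _ HC); clear HC.
set (w := (z * / (2 * PI)) ^ 2).
assert (Hz2 : 0 < z ^ 2 < 1).
{ apply Rabs_def2 in Hz1; split; [|nra]. apply pow2_gt_0, Hz. }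
assert (Hi : 0 < / (2 * PI) < 1).
{ split; [apply Rinv_0_lt_compat; lra|].
  rewrite <- Rinv_1; apply Rinv_lt_contravar; lra. }
assert (Hw : 0 < w < 1).
{ unfold w; rewrite Rpow_mult_distr.
  assert (0 < (/ (2 * PI)) ^ 2 < 1) by (split; nra). nra. }
set (f := fun j k => 2 * (-1) ^ j * (w * / INR (S k) ^ 2) ^ S j).
assert (Hk : forall k, 0 < / INR (S k) ^ 2 <= 1).
{ intros k; split; [apply (inv_pow_le_sqr k 2 (le_n 2))|].
  rewrite <- Rinv_1; apply Rinv_le_contravar; [lra|].
  apply pow_R1_Rle; rewrite S_INR; pose proof (pos_INR k); lra. }
rewrite (Series_ext _ (fun k => Series (fun j => f j k))).
2: { intros k; symmetry; apply is_series_unique; unfold f.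
     specialize (Hk k); pose proof (lt_0_INR (S k) ltac:(lia)) as HK.
     set (q := w * / INR (S k) ^ 2) in *.
     assert (Hq : 0 < q < 1) by (unfold q; nra).
     replace (z / 2 * (2 * (z / 2) / ((z / 2) ^ 2 + (INR (S k) * PI) ^ 2)))
       with (2 * q * / (1 - - q)).
     - apply (is_series_ext (fun j => 2 * q * (- q) ^ j)).
       + intros j; replace (- q) with (-1 * q) by ring.
         rewrite Rpow_mult_distr; simpl; ring.
       + apply is_series_mult_l, is_series_geom; rewrite Rabs_Ropp, Rabs_pos_eq; lra.
     - unfold q, w; set (K := INR (S k)) in *.
       assert (0 < K * PI) by nra.
       field; repeat split; try lra; nra. }
apply (is_series_ext (fun j => Series (f j))).
{ intros j; unfold f; eq_in_R.
  rewrite (Series_ext _ (fun k => 2 * (-1) ^ j * w ^ S j * / INR (S k) ^ (2 * S j))).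
  - rewrite Series_scal_l; fold (zeta_nat (2 * S j)).
    unfold bern_even_coef, w.
    rewrite (pow_mult (/ (2 * PI)) 2 (S j)), !Rpow_mult_distr; ring.
  - intros k; rewrite Rpow_mult_distr, pow_mult, (pow_inv (INR (S k) ^ 2)); ring. }
apply is_series_swap with (u := fun j => 2 * w ^ S j) (v := fun k => / INR (S k) ^ 2).
- apply ex_series_mult_l.
  apply (ex_series_ext (fun j => w * w ^ j)); [reflexivity|].
  apply ex_series_mult_l; eexists; apply is_series_geom; rewrite Rabs_pos_eq; lra.
- apply ex_series_inv_sqr.
- intros j; pose proof (pow_lt w (S j) ltac:(lra)); lra.
- intros k; left; apply Hk.
- intros j k; unfold f; specialize (Hk k); set (r := / INR (S k) ^ 2) in *.
  rewrite !Rabs_mult, pow_1_abs, (Rabs_pos_eq 2), Rmult_1_r, Rmult_assoc by lra.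
  apply Rmult_le_compat_l; [lra|].
  rewrite Rpow_mult_distr.
  assert (0 < w ^ S j) by (apply pow_lt; lra).
  assert (0 < r ^ j <= 1) by (split; [apply pow_lt; lra|rewrite <- (pow1 j); apply pow_incr; lra]).
  assert (0 <= r ^ S j <= r) by (simpl; nra).
  rewrite Rabs_pos_eq by (apply Rmult_le_pos; lra).
  apply Rmult_le_compat_l; lra.
Qed.

Lemma is_series_zero : is_series (fun _ : nat => 0) 0.
Proof.
pose proof (is_series_geom 0) as H; rewrite Rabs_R0 in H.
apply (is_series_mult_l 0) in H; [|lra]; rewrite Rmult_0_l in H.
eapply is_series_ext; [|exact H]; intros n; apply Rmult_0_l.
Qed.

(** [z / (exp z - 1) = (z / 2) coth (z / 2) - z / 2]: the hyperbolic cotangent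
    gives the even coefficients, and [- z / 2] the only odd one. *)
Lemma bern_egf_pseries z :
  z <> 0 -> Rabs z < 1 -> is_pseries bern_egf_coef z (z / (exp z - 1)).
Proof.
intros Hz Hz1.
assert (He1 : exp z - 1 <> 0).
{ intros E; apply Hz, exp_inv; rewrite exp_0; lra. }
replace (z / (exp z - 1))
  with (z / 2 * (cosh (z / 2) / sinh (z / 2)) + z * - (1 / 2)).
2: { assert (E : exp z = exp (z / 2) * exp (z / 2)) by (rewrite <- exp_plus; f_equal; lra).
     unfold cosh, sinh; rewrite exp_Ropp; rewrite E in *.
     pose proof (exp_pos (z / 2)); field; repeat split; lra. }
apply is_pseries_odd_even.
- apply is_series_decr_1.
  eapply is_series_ext; [|].
  2: { replace (plus _ _) with (z / 2 * (cosh (z / 2) / sinh (z / 2)) - 1).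
       + apply coth_power_series; assumption.
       + simpl; unfold plus, opp, scal; simpl; unfold mult, one, bern_egf_coef; simpl; ring. }
  intros j; rewrite pow_n_pow; unfold bern_egf_coef.
  replace (Nat.even (2 * S j)) with true
    by (symmetry; apply Nat.even_spec; now exists (S j)).
  rewrite Nat.div2_double; apply Rmult_comm.
- apply is_series_decr_1.
  apply (is_series_ext (fun _ => 0)).
  + intros j; unfold bern_egf_coef.
    replace (Nat.even (2 * S j + 1)) with false by (rewrite Nat.even_add, Nat.even_mul; reflexivity).
    destruct (Nat.eqb_spec (2 * S j + 1) 1); [lia|].
    symmetry; apply Rmult_0_r.
  + replace (plus _ _) with 0.
    * apply is_series_zero.
    * change (0 = - (1 / 2) + - (1 * - (1 / 2))); ring.
Qed.

Lemma CV_radius_pos (a : nat -> R) (x : R) :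
  x <> 0 -> ex_pseries a x -> Rbar_lt 0 (CV_radius a).
Proof.
intros Hx Ha; apply Rbar_lt_le_trans with (Rabs x); [now apply Rabs_pos_lt|].
apply Rbar_not_lt_le; intros Hlt; apply (CV_disk_outside a x Hlt).
apply ex_series_lim_0 in Ha; eapply is_lim_seq_ext; [|exact Ha].
intros n; rewrite pow_n_pow; apply Rmult_comm.
Qed.

(** Uniqueness of power series coefficients. The generating identity says
    nothing at [z = 0], so the series multiplied by [z] are compared: these
    agree at 0 as well. *)
Lemma bernoulli_egf_coef (B : nat -> R) (n : nat) :
  bernoulli_numbers B -> B n / INR (fact n) = bern_egf_coef n.
Proof.
intros [eps HB].
assert (HB' : forall z, z <> 0 -> Rabs z < eps ->
  is_pseries (fun j => B j / INR (fact j)) z (z / (exp z - 1))).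
{ intros z Hz Hze.
  assert (Hball : ball 0 eps z).
  { unfold ball; simpl; unfold AbsRing_ball, abs, minus, plus, opp; simpl.
    now rewrite Ropp_0, Rplus_0_r. }
  eapply is_series_ext; [|exact (HB z Hball Hz)].
  intros j; rewrite pow_n_pow.
  change (B j * (z ^ j / INR (fact j)) = z ^ j * (B j / INR (fact j))).
  unfold Rdiv; ring. }
set (a := fun j => B j / INR (fact j)) in *.
set (r := Rmin eps 1).
assert (Hr : 0 < r) by (unfold r; apply Rmin_pos; [apply cond_pos|lra]).
assert (Hre : r <= eps /\ r <= 1) by (split; [apply Rmin_l|apply Rmin_r]).
assert (Hr2 : Rabs (r / 2) = r / 2) by (rewrite Rabs_pos_eq; lra).
change (PS_incr_1 a (S n) = PS_incr_1 bern_egf_coef (S n)).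
apply PSeries_ext_recip.
- rewrite CV_radius_incr_1; apply (CV_radius_pos _ (r / 2)); [lra|].
  eexists; apply HB'; lra.
- rewrite CV_radius_incr_1; apply (CV_radius_pos _ (r / 2)); [lra|].
  eexists; apply bern_egf_pseries; lra.
- exists (mkposreal r Hr); intros z Hz.
  assert (Hz1 : Rabs z < r).
  { unfold ball in Hz; simpl in Hz; unfold AbsRing_ball, abs, minus, plus, opp in Hz.
    simpl in Hz; now rewrite Ropp_0, Rplus_0_r in Hz. }
  rewrite !PSeries_incr_1.
  destruct (Req_dec z 0) as [->|Hz0]; [ring|f_equal].
  transitivity (z / (exp z - 1)).
  + apply is_pseries_unique, HB'; lra.
  + symmetry; apply is_pseries_unique, bern_egf_pseries; lra.
Qed.

Lemma bernoulli_even (B : nat -> R) (k : nat) :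
  bernoulli_numbers B -> B (2 * k)%nat / INR (fact (2 * k)) = bern_even_coef k.
Proof.
intros HB; rewrite (bernoulli_egf_coef B _ HB); unfold bern_egf_coef.
replace (Nat.even (2 * k)) with true by (symmetry; apply Nat.even_spec; now exists k).
now rewrite Nat.div2_double.
Qed.

(** * The reciprocity of the lattice sums *)

Lemma cosh_div_sinh x :
  0 < x -> cosh x / sinh x = 1 + 2 / (exp (2 * x) - 1).
Proof.
intros Hx; replace (2 * x) with (x + x) by ring.
pose proof (exp_ineq1 x ltac:(lra)).
unfold cosh, sinh; rewrite exp_Ropp, exp_plus.
field; repeat split; try lra; nra.
Qed.

Lemma powerRZ_neg_nat x n : powerRZ x (- Z.of_nat n) = / x ^ n.
Proof. now rewrite powerRZ_neg', pow_powerRZ. Qed.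

(** What remains of the Lambert series once the partial fractions of [coth] are
    inserted. Exchanging [alpha] with [beta] and the two summations changes only
    the factor in front of [/ (alpha n ^ 2 + beta k ^ 2)]. *)
Definition lattice_sum (alpha beta : R) (m : nat) : R :=
  Series (fun n => Series (fun k =>
    / INR (S n) ^ (2 * m) * / (alpha * INR (S n) ^ 2 + beta * INR (S k) ^ 2))).

(** Dropping the term in [alpha] from the denominator gives a product majorant,
    which is summable as soon as [1 <= m]. *)
Lemma lattice_term_bound alpha beta m n k :
  0 < alpha -> 0 < beta ->
  Rabs (/ INR (S n) ^ (2 * m) * / (alpha * INR (S n) ^ 2 + beta * INR (S k) ^ 2))
  <= / INR (S n) ^ (2 * m) * (/ beta * / INR (S k) ^ 2).
Proof.
intros Ha Hb.
assert (H : forall i, 0 < INR (S i) ^ 2)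
  by (intros i; apply pow_lt, lt_0_INR; lia).
pose proof (H n); pose proof (H k).
assert (0 < / INR (S n) ^ (2 * m))
  by (apply Rinv_0_lt_compat, pow_lt, lt_0_INR; lia).
assert (0 < beta * INR (S k) ^ 2) by (apply Rmult_lt_0_compat; lra).
assert (0 < alpha * INR (S n) ^ 2) by (apply Rmult_lt_0_compat; lra).
assert (0 < / (alpha * INR (S n) ^ 2 + beta * INR (S k) ^ 2))
  by (apply Rinv_0_lt_compat; lra).
rewrite Rabs_pos_eq by (apply Rmult_le_pos; lra).
apply Rmult_le_compat_l; [lra|].
rewrite <- Rinv_mult; apply Rinv_le_contravar; lra.
Qed.

Lemma lattice_sum_swap alpha beta m :
  0 < alpha -> 0 < beta -> (1 <= m)%nat ->
  is_series (fun n => Series (fun k =>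
    / INR (S k) ^ (2 * m) * / (alpha * INR (S k) ^ 2 + beta * INR (S n) ^ 2)))
    (lattice_sum alpha beta m).
Proof.
intros Ha Hb Hm; unfold lattice_sum.
apply (is_series_swap (fun n k => / INR (S k) ^ (2 * m) *
         / (alpha * INR (S k) ^ 2 + beta * INR (S n) ^ 2))
         (fun n => / beta * / INR (S n) ^ 2) (fun k => / INR (S k) ^ (2 * m))).
- apply ex_series_mult_l, ex_series_inv_sqr.
- apply ex_series_inv_pow; lia.
- intros j; rewrite <- Rinv_mult; left; apply Rinv_0_lt_compat, Rmult_lt_0_compat;
    [exact Hb|apply pow_lt, lt_0_INR; lia].
- intros k; left; apply Rinv_0_lt_compat, pow_lt, lt_0_INR; lia.
- intros j k; rewrite (Rmult_comm (/ beta * _)); now apply lattice_term_bound.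
Qed.

Lemma lattice_sum_correct alpha beta m :
  0 < alpha -> 0 < beta -> (1 <= m)%nat ->
  is_series (fun n => Series (fun k =>
    / INR (S n) ^ (2 * m) * / (alpha * INR (S n) ^ 2 + beta * INR (S k) ^ 2)))
    (lattice_sum alpha beta m).
Proof.
intros Ha Hb Hm; apply Series_correct.
eexists; apply is_series_swap with (u := fun n => / INR (S n) ^ (2 * m))
  (v := fun k => / beta * / INR (S k) ^ 2).
- apply ex_series_inv_pow; lia.
- apply ex_series_mult_l, ex_series_inv_sqr.
- intros k; left; apply Rinv_0_lt_compat, pow_lt, lt_0_INR; lia.
- intros j; rewrite <- Rinv_mult; left; apply Rinv_0_lt_compat, Rmult_lt_0_compat;
    [exact Hb|apply pow_lt, lt_0_INR; lia].
- intros j k; now apply lattice_term_bound.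
Qed.

(** Since [1 / 2 + 1 / (exp (2 x) - 1) = coth x / 2], the zeta value completes
    each exponential term to a hyperbolic cotangent at [x = alpha n]. Its
    partial fractions have denominators
    [alpha ^ 2 n ^ 2 + PI ^ 2 k ^ 2 = alpha (alpha n ^ 2 + beta k ^ 2)]; this is
    where [alpha * beta = PI ^ 2] makes the two sides symmetric. *)
Lemma lambert_sum_eq alpha beta m :
  0 < alpha -> 0 < beta -> alpha * beta = PI ^ 2 -> (1 <= m)%nat ->
  1 / 2 * zeta (INR (2 * m + 1)) +
    Series (fun n => powerRZ (INR (S n)) (- 2 * Z.of_nat m - 1) /
                     (exp (2 * alpha * INR (S n)) - 1))
  = zeta_nat (2 * m + 2) / (2 * alpha) + lattice_sum alpha beta m.
Proof.
intros Ha Hb Hab Hm; rewrite zeta_INR.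
assert (H : is_series (fun n =>
    powerRZ (INR (S n)) (- 2 * Z.of_nat m - 1) / (exp (2 * alpha * INR (S n)) - 1))
  (/ (2 * alpha) * zeta_nat (2 * m + 2) + lattice_sum alpha beta m
     + - (1 / 2) * zeta_nat (2 * m + 1))).
2: { rewrite (is_series_unique _ _ H); field; lra. }
pose proof (lattice_sum_correct alpha beta m Ha Hb Hm) as HL.
pose proof (is_series_mult_l (/ (2 * alpha)) _ _
  (Series_correct _ (ex_series_inv_pow (2 * m + 2) ltac:(lia)))) as H2.
pose proof (is_series_mult_l (- (1 / 2)) _ _
  (Series_correct _ (ex_series_inv_pow (2 * m + 1) ltac:(lia)))) as H1.
pose proof (is_series_add _ _ _ _ (is_series_add _ _ _ _ H2 HL) H1) as H.
eapply is_series_ext; [|exact H]; clear H H1 H2 HL.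
intros n; eq_in_R.
replace (- 2 * Z.of_nat m - 1)%Z with (- Z.of_nat (2 * m + 1))%Z by lia.
rewrite powerRZ_neg_nat.
pose proof (lt_0_INR (S n) ltac:(lia)) as HN; set (N := INR (S n)) in *.
assert (HaN : 0 < alpha * N) by nra.
pose proof (coth_partial_fractions (alpha * N) ltac:(lra)) as HC.
apply (is_series_mult_l (/ 2 * / N ^ (2 * m + 1))) in HC.
rewrite cosh_div_sinh in HC by exact HaN.
assert (HNp : forall j, 0 < N ^ j) by (intros j; now apply pow_lt).
rewrite (Series_ext _ (fun k => / 2 * / N ^ (2 * m + 1) *
  (2 * (alpha * N) / ((alpha * N) ^ 2 + (INR (S k) * PI) ^ 2)))).
2: { intros k; pose proof (lt_0_INR (S k) ltac:(lia)) as HK; set (K := INR (S k)) in *.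
     replace ((alpha * N) ^ 2 + (K * PI) ^ 2) with (alpha * (alpha * N ^ 2 + beta * K ^ 2))
       by (rewrite (Rpow_mult_distr K), <- Hab; ring).
     pose proof (HNp (2 * m)%nat); pose proof (pow_lt K 2 HK).
     rewrite (pow_add N (2 * m) 1), (pow_1 N). field; repeat split; nra. }
rewrite (is_series_unique _ _ HC).
pose proof (exp_ineq1 (2 * (alpha * N)) ltac:(lra)).
replace (2 * alpha * N) with (2 * (alpha * N)) by ring.
pose proof (HNp (2 * m)%nat).
rewrite (pow_add N (2 * m) 1), (pow_add N (2 * m) 2), (pow_1 N).
field; repeat split; lra.
Qed.

Lemma geometric_difference (x y : R) (p : nat) :
  x ^ S p - y ^ S p = (x - y) * sum_f_R0 (fun i => x ^ i * y ^ (p - i)) p.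
Proof.
induction p as [|p IH]; [simpl; ring|].
rewrite tech5, Nat.sub_diag.
rewrite (sum_eq _ (fun i => x ^ i * y ^ (p - i) * y)).
2: { intros i Hi; rewrite Nat.sub_succ_l by exact Hi; simpl; ring. }
rewrite <- scal_sum.
replace (x ^ S (S p) - y ^ S (S p))
  with (y * (x ^ S p - y ^ S p) + (x - y) * x ^ S p) by (simpl; ring).
rewrite IH; simpl; ring.
Qed.

(** The factor [a + b] cancels: with [x = / a] and [y = - / b] one has
    [x - y = (a + b) / (a b)], and [x ^ m - y ^ m] is divisible by [x - y]. *)
Lemma kernel_difference (a b : R) (p : nat) :
  0 < a -> 0 < b ->
  (/ a ^ S p - / (- b) ^ S p) * / (a + b) =
  sum_f_R0 (fun i => (-1) ^ (p - i) * / a ^ S i * / b ^ S (p - i)) p.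
Proof.
intros Ha Hb.
rewrite <- !pow_inv, geometric_difference.
replace ((/ a - / - b) * _ * / (a + b))
  with (/ a * / b * sum_f_R0 (fun i => (/ a) ^ i * (/ - b) ^ (p - i)) p)
  by (field; lra).
rewrite scal_sum; apply sum_eq; intros i Hi.
rewrite <- !pow_inv; replace (/ - b) with (-1 * / b) by (field; lra).
rewrite Rpow_mult_distr; simpl; ring.
Qed.

(** Put [a = alpha n ^ 2] and [b = beta k ^ 2]. After the second sum is
    reordered, the two summands at [(n, k)] are [/ a ^ m] and [/ (- b) ^ m] times
    [/ (a + b)], so their difference is a finite sum of products of a power of
    [n] and a power of [k], and the double series factors. *)
Lemma lattice_sum_reciprocity alpha beta p :
  0 < alpha -> 0 < beta ->
  / alpha ^ S p * lattice_sum alpha beta (S p)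
  - / (- beta) ^ S p * lattice_sum beta alpha (S p) =
  sum_f_R0 (fun i => (-1) ^ (p - i) * / alpha ^ S i * / beta ^ S (p - i) *
    zeta_nat (2 * S i) * zeta_nat (2 * S (p - i))) p.
Proof.
intros Ha Hb.
pose proof (is_series_mult_l (/ alpha ^ S p) _ _
  (lattice_sum_correct alpha beta (S p) Ha Hb ltac:(lia))) as HF.
pose proof (is_series_mult_l (- / (- beta) ^ S p) _ _
  (lattice_sum_swap beta alpha (S p) Hb Ha ltac:(lia))) as HG.
pose proof (is_series_add _ _ _ _ HF HG) as H; clear HF HG.
assert (HZ : forall s, is_series (fun n => / INR (S n) ^ (2 * S s)) (zeta_nat (2 * S s)))
  by (intros s; apply Series_correct, ex_series_inv_pow; lia).
set (c := fun i => (-1) ^ (p - i) * / alpha ^ S i * / beta ^ S (p - i)).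
assert (HS : is_series (fun n => sum_f_R0 (fun i =>
    c i * zeta_nat (2 * S (p - i)) * / INR (S n) ^ (2 * S i)) p)
  (sum_f_R0 (fun i => c i * zeta_nat (2 * S (p - i)) * zeta_nat (2 * S i)) p)).
{ rewrite (sum_eq _ (fun i =>
    Series (fun n => c i * zeta_nat (2 * S (p - i)) * / INR (S n) ^ (2 * S i)))).
  - apply (Series_sum_f_R0 (fun i n =>
      c i * zeta_nat (2 * S (p - i)) * / INR (S n) ^ (2 * S i))).
    intros j; apply ex_series_mult_l; eexists; apply HZ.
  - intros i _; now rewrite Series_scal_l. }
apply is_series_unique in H; apply is_series_unique in HS.
transitivity (sum_f_R0 (fun i => c i * zeta_nat (2 * S (p - i)) * zeta_nat (2 * S i)) p).
2: { apply sum_eq; intros i _; unfold c; ring. }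
rewrite <- HS.
match goal with |- ?a - ?b * ?d = _ => replace (a - b * d) with (a + - b * d) by ring end.
transitivity (1 * (/ alpha ^ S p * lattice_sum alpha beta (S p) +
  - / (- beta) ^ S p * lattice_sum beta alpha (S p))); [ring|].
rewrite Rmult_1_l; etransitivity; [symmetry; exact H|].
apply Series_ext; intros n.
assert (HN : forall j, 0 < INR (S j)) by (intros j; apply lt_0_INR; lia).
rewrite <- !Series_scal_l, <- Series_plus.
2: { apply ex_series_mult_l, (ex_series_abs_le _
       (fun k => / INR (S n) ^ (2 * S p) * (/ beta * / INR (S k) ^ 2))).
     - do 2 apply ex_series_mult_l; apply ex_series_inv_sqr.
     - intros k; now apply lattice_term_bound. }
2: { apply ex_series_mult_l, (ex_series_abs_le _
       (fun k => (/ alpha * / INR (S n) ^ 2) * / INR (S k) ^ (2 * S p))).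
     - apply ex_series_mult_l; eexists; apply HZ.
     - intros k; rewrite Rmult_comm; rewrite (Rmult_comm (_ * _)).
       rewrite (Rmult_comm (/ _)). now apply lattice_term_bound. }
rewrite (Series_ext _ (fun k => sum_f_R0 (fun i =>
  c i * / INR (S n) ^ (2 * S i) * / INR (S k) ^ (2 * S (p - i))) p)).
- rewrite (is_series_unique _ _ (Series_sum_f_R0 (fun i k =>
    c i * / INR (S n) ^ (2 * S i) * / INR (S k) ^ (2 * S (p - i))) p
    ltac:(intros j; apply ex_series_mult_l; eexists; apply HZ))).
  apply sum_eq; intros i _; rewrite Series_scal_l; fold (zeta_nat (2 * S (p - i))); ring.
- intros k; pose proof (HN n) as Hn; pose proof (HN k) as Hk.
  set (N := INR (S n)) in *; set (K := INR (S k)) in *.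
  assert (HN2 : 0 < N ^ 2) by now apply pow_lt.
  assert (HK2 : 0 < K ^ 2) by now apply pow_lt.
  assert (HaN : 0 < alpha * N ^ 2) by nra.
  assert (HbK : 0 < beta * K ^ 2) by nra.
  transitivity ((/ (alpha * N ^ 2) ^ S p - / (- (beta * K ^ 2)) ^ S p)
                * / (alpha * N ^ 2 + beta * K ^ 2)).
  + replace (- (beta * K ^ 2)) with (- beta * K ^ 2) by ring.
    rewrite !Rpow_mult_distr, !Rinv_mult, !(pow_mult _ 2).
    rewrite (Rplus_comm (beta * K ^ 2)); ring.
  + rewrite kernel_difference by assumption.
    apply sum_eq; intros i _; unfold c.
    rewrite !Rpow_mult_distr, !Rinv_mult, !(pow_mult _ 2); ring.
Qed.

(** * The reciprocity formula *)

Lemma bern_even_coef_S alpha beta j :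
  alpha * beta = PI ^ 2 ->
  bern_even_coef (S j) =
  2 * (-1) ^ j * zeta_nat (2 * S j) * / (4 ^ S j * alpha ^ S j * beta ^ S j).
Proof.
intros Hab; unfold bern_even_coef.
rewrite (pow_mult _ 2), pow_inv, Rpow_mult_distr, <- Hab, pow_inv.
replace (2 ^ 2) with 4 by ring; now rewrite !Rpow_mult_distr, <- (Rmult_assoc (4 ^ S j)).
Qed.

Lemma sqr_pow_m1 n : (-1) ^ n * (-1) ^ n = 1.
Proof. rewrite <- Rpow_mult_distr; replace (-1 * -1) with 1 by ring; apply pow1. Qed.

Theorem theorem1p1 (B : nat -> R) (HB : bernoulli_numbers B)
  (alpha beta : R) (Halpha : 0 < alpha) (Hbeta : 0 < beta)
  (Hab : alpha * beta = PI ^ 2) (m : nat) (Hm : (1 <= m)%nat) :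
  powerRZ alpha (- Z.of_nat m) *
    (1 / 2 * zeta (INR (2 * m + 1)) +
     Series (fun n => powerRZ (INR (S n)) (- 2 * Z.of_nat m - 1) /
                      (exp (2 * alpha * INR (S n)) - 1)))
  - powerRZ (- beta) (- Z.of_nat m) *
    (1 / 2 * zeta (INR (2 * m + 1)) +
     Series (fun n => powerRZ (INR (S n)) (- 2 * Z.of_nat m - 1) /
                      (exp (2 * beta * INR (S n)) - 1)))
  = 2 ^ (2 * m) *
    sum_f_R0 (fun k =>
      powerRZ (-1) (Z.of_nat k - 1) * B (2 * k)%nat * B (2 * m + 2 - 2 * k)%nat /
        (INR (fact (2 * k)) * INR (fact (2 * m + 2 - 2 * k))) *
        alpha ^ (m + 1 - k) * beta ^ k) (m + 1).
Proof.
destruct m as [|p]; [lia|clear Hm].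
rewrite (lambert_sum_eq alpha beta) by (assumption || lia).
rewrite (lambert_sum_eq beta alpha _ Hbeta Halpha (eq_trans (Rmult_comm beta alpha) Hab)) by lia.
rewrite !powerRZ_neg_nat.
assert (Hpow : forall j, 0 < alpha ^ j /\ 0 < beta ^ j /\ 0 < 4 ^ j)
  by (intros j; repeat split; apply pow_lt; lra).
(* the summand on the right, in terms of zeta values; k = 0 and k = m + 1 are the
   ends, where [bern_even_coef 0 = 1] is not a zeta value *)
set (T := fun k => powerRZ (-1) (Z.of_nat k - 1) * bern_even_coef k *
  bern_even_coef (S (S p) - k) * alpha ^ (S (S p) - k) * beta ^ k).
rewrite (sum_eq _ T).
2: { intros k Hk; unfold T.
     rewrite <- !(bernoulli_even B _ HB).
     replace (2 * S p + 2 - 2 * k)%nat with (2 * (S (S p) - k))%nat by lia.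
     replace (S p + 1 - k)%nat with (S (S p) - k)%nat by lia.
     field; split; apply INR_fact_neq_0. }
rewrite Nat.add_1_r, tech5, decomp_sum by lia; simpl pred.
replace (2 * S p + 2)%nat with (2 * S (S p))%nat by lia.
set (z := zeta_nat (2 * S (S p))).
rewrite pow_mult; replace (2 ^ 2) with 4 by ring.
pose proof (lattice_sum_reciprocity alpha beta p Halpha Hbeta) as HR.
(* the signs (-1) ^ i of the summand and of [bern_even_coef (S i)] cancel *)
rewrite (sum_eq _ (fun i => T (S i) * 4 ^ S p)) in HR.
2: { intros i Hi; unfold T; set (q := (p - i)%nat).
     replace (S (S p) - S i)%nat with (S q) by lia.
     replace (S p) with (S (i + q)) by lia.
     replace (Z.of_nat (S i) - 1)%Z with (Z.of_nat i) by lia.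
     rewrite <- pow_powerRZ, !(bern_even_coef_S alpha beta) by exact Hab.
     transitivity (((-1) ^ i * (-1) ^ i) *
       ((-1) ^ q * / alpha ^ S i * / beta ^ S q * zeta_nat (2 * S i) * zeta_nat (2 * S q))).
     { rewrite sqr_pow_m1; ring. }
     pose proof (Hpow i) as [? [? ?]]; pose proof (Hpow q) as [? [? ?]].
     change (4 ^ S (i + q)) with (4 * 4 ^ (i + q)); rewrite pow_add.
     rewrite <- !tech_pow_Rmult.
     field; repeat split; lra. }
rewrite <- scal_sum in HR.
assert (H0 : 4 ^ S p * T 0%nat = - (/ (- beta) ^ S p * (z / (2 * beta)))).
{ unfold T; rewrite Nat.sub_0_r, (bern_even_coef_S alpha beta) by exact Hab; fold z.
  replace (- beta) with (-1 * beta) by ring; rewrite Rpow_mult_distr, (Rinv_mult ((-1) ^ S p)).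
  rewrite <- (pow_inv (-1)); replace (/ -1) with (-1) by field.
  pose proof (Hpow p) as [? [? ?]].
  simpl powerRZ; unfold bern_even_coef; rewrite <- !tech_pow_Rmult.
  rewrite pow_O; set (s := (-1) ^ p); field; lra. }
assert (HL : 4 ^ S p * T (S (S p)) = / alpha ^ S p * (z / (2 * alpha))).
{ unfold T; rewrite Nat.sub_diag, (bern_even_coef_S alpha beta) by exact Hab; fold z.
  replace (Z.of_nat (S (S p)) - 1)%Z with (Z.of_nat (S p)) by lia.
  rewrite <- pow_powerRZ.
  transitivity (((-1) ^ S p * (-1) ^ S p) * (/ alpha ^ S p * (z / (2 * alpha)))).
  2: { rewrite sqr_pow_m1; ring. }
  pose proof (Hpow p) as [? [? ?]].
  unfold bern_even_coef; rewrite <- !tech_pow_Rmult, pow_O; field; lra. }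
rewrite !Rmult_plus_distr_l, H0, HL; lra.
Qed.
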